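(* Let $n\ge2$ and let $(X,F)$ be a symmetric $n$-ary band. For $x,y\in X$ put $B(x,y)=\ell_x(y)=F(x,\ldots,x,y)$, with $x$ repeated $n-1$ times, and let $\ell\colon X\to T_X$ be the map $\ell(x)=\ell_x$, where $T_X$ is the set of all maps from $X$ to $X$. The following assertions are equivalent. (i) The map $\ell$ is injective. (ii) The $n$-ary band $(X,F)$ is (isomorphic to) the $n$-ary extension of a semilattice. (iii) The band $(X,B)$ is commutative. (iv) The $n$-ary band $(X,F)$ is the $n$-ary extension of $(X,B)$.
   Context: An operation $F\colon X^n\to X$ ($X$ nonempty) is associative if $F(x_1,\ldots,x_{i-1},F(x_i,\ldots,x_{i+n-1}),x_{i+n},\ldots,x_{2n-1})=F(x_1,\ldots,x_i,F(x_{i+1},\ldots,x_{i+n}),x_{i+n+1},\ldots,x_{2n-1})$ for all $x_1,\ldots,x_{2n-1}\in X$ and $1\le i\le n-1$. A symmetric $n$-ary band is a pair $(X,F)$ with $F$ associative, invariant under permutations of its arguments, and idempotent ($F(x,\ldots,x)=x$ for all $x$). A band is an idempotent semigroup; $(X,B)$ is a band. A semilattice is a commutative band. The $n$-ary extension of a semigroup $(X,\ast)$ is $(X,F)$ with $F(x_1,\ldots,x_n)=x_1\ast\cdots\ast x_n$. Two pairs $(X,F)$, $(X',F')$ with $n$-ary operations are isomorphic if there is a bijection $\varphi\colon X\to X'$ with $\varphi(F(x_1,\ldots,x_n))=F'(\varphi(x_1),\ldots,\varphi(x_n))$ for all $x_1,\dots,x_n\in X$. *)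

(* Defs.v *)
From HB Require Import structures.
From mathcomp Require Import all_boot all_fingroup.

Set Implicit Arguments.
Unset Strict Implicit.
Unset Printing Implicit Defensive.

Section NaryOperations.
Variables (n : nat) (X : Type).
Implicit Types (F : n.-tuple X -> X) (op : X -> X -> X).

(* Indices start at 0: this is
     F (x_0, .., x_(i-1), F (x_i, .., x_(i+n-1)), x_(i+n), .., x_(2n-2)).
   For i < n only the first 2n-1 terms of the sequence x are used. *)
Definition nested F (x : nat -> X) (i : nat) : X :=
  F [tuple if (j < i)%N then x j
           else if j == i :> nat then F [tuple x (i + k)%N | k < n]
           else x (j + n.-1)%N | j < n].

Definition nary_associative F : Prop :=
  forall (x : nat -> X) (i : nat), (i.+1 < n)%N ->
    nested F x i = nested F x i.+1.

Definition nary_symmetric F : Prop :=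
  forall (s : 'S_n) (t : n.-tuple X), F [tuple tnth t (s i) | i < n] = F t.

Definition nary_idempotent F : Prop := forall x : X, F [tuple x | _ < n] = x.

Definition symmetric_nary_band F : Prop :=
  [/\ nary_associative F, nary_symmetric F & nary_idempotent F].

Definition ell F (x : X) : X -> X :=
  fun y => F [tuple if (i < n.-1)%N then x else y | i < n].

Definition binary_op F (x y : X) : X := ell F x y.

Definition semilattice op : Prop :=
  [/\ associative op, idempotent_op op & commutative op].

(* Meaningful for 0 < n only: a semigroup has no empty product. *)
Definition nary_extension_of op F : Prop :=
  forall (t : n.-tuple X) (x : X) (s : seq X),
    t = x :: s :> seq X -> F t = foldl op x s.

End NaryOperations.

Definition nary_isomorphic (n : nat) (X Y : Type)
    (F : n.-tuple X -> X) (G : n.-tuple Y -> Y) : Prop :=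
  exists2 phi : X -> Y, bijective phi &
    forall t : n.-tuple X, phi (F t) = G (map_tuple phi t).

(* Main.v *)
Require Import Defs.
From HB Require Import structures.
From mathcomp Require Import all_boot all_fingroup.
From mathcomp Require Import zify.
From Stdlib Require Import Permutation FunctionalExtensionality.

Set Implicit Arguments.
Unset Strict Implicit.
Unset Printing Implicit Defensive.

(** Associativity and symmetry make the iterated products of F, which have
    k (n - 1) + 1 factors, independent of the order of their factors
    ([long_prod_perm]).  Everything follows from reordering such products.

    Write B for the binary operation.  Both B x (B y z) and B y (B x z) are the
    product of n - 1 copies of x, n - 1 copies of y, and z, so the maps ell x
    commute.  In the product of n - 1 copies of F (t_1, .., t_n) and z, expand
    each copy and collect the n - 1 copies of each t_i: this gives
      ell (F t) = ell t_1 o .. o ell t_n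
    ([ell_prod]).  As every ell x is idempotent, the instance
    t = (x, .., x, y) reads ell (B x y) = ell x o ell y, that is, B is
    associative.  Thus ell (B x y) = ell (B y x), and ell (F t) is ell of the
    B-product of t.  If ell is injective, ell can be cancelled in both
    equalities, so that B is commutative and F extends B.

    Conversely, let B be commutative.  If ell x = ell y, then
    x = B x x = B y x = B x y = B y y = y, so ell is injective.

    The other two assertions imply that B is commutative.  An extension of a
    semilattice * has * as its operation B, since x * .. * x * y = x * y, and
    an isomorphism transports this.  If F extends B, the values of F at
    (x, .., x, y) and (y, x, .., x) are B x y and B y x, by associativity and
    idempotence of B; they agree because F is symmetric. *)

(** * Permutations of sequences *)

Lemma Permutation_catC (T : Type) (s t : seq T) :
  Permutation (s ++ t) (t ++ s).
Proof. exact: Permutation_app_comm. Qed.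

Lemma Permutation_cat2r (T : Type) (r s t : seq T) :
  Permutation s t -> Permutation (s ++ r) (t ++ r).
Proof. exact: Permutation_app_tail. Qed.

Lemma Permutation_flatten_nseq (X : Type) j (s : seq X) :
  Permutation (flatten (nseq j s)) (flatten [seq nseq j x | x <- s]).
Proof.
elim: j => [|j IHj]; first by elim: s.
apply: Permutation_trans (Permutation_app_head s IHj) _ => {IHj}.
elim: s => [//|x s IHs] /=; apply: perm_skip.
apply: Permutation_trans (Permutation_app_swap_app _ _ _) _.
exact: Permutation_app_head.
Qed.

(** * Arity-n products of sequences *)

(** Totality on sequences frees the block manipulations below from casts
    between tuple types; the default x0 matters only for sequences shorter
    than n. *)
Definition seq_prod (n : nat) (X : Type) (F : n.-tuple X -> X) (x0 : X)
  (s : seq X) : X := F [tuple nth x0 s i | i < n].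

Lemma seq_prodE n X (F : n.-tuple X -> X) x0 (t : n.-tuple X) :
  seq_prod F x0 t = F t.
Proof.
by congr F; apply: eq_from_tnth => i; rewrite tnth_mktuple (tnth_nth x0).
Qed.

(** Turns the index-based nested products into products of sequences, in which
    the position of the inner F is a splitting of the sequence. *)
Lemma nested_cat n X (F : n.-tuple X -> X) x0 a b c : size b = n ->
  nested F (nth x0 (a ++ b ++ c)) (size a) =
  seq_prod F x0 (a ++ seq_prod F x0 b :: c).
Proof.
move=> szb; congr F; apply: eq_from_tnth => j; rewrite !tnth_mktuple.
rewrite !nth_cat; case: ltngtP => [//|lt_aj|eq_ja].
- have lt_jn := ltn_ord j.
  have -> : (j + n.-1 < size a)%N = false by lia.
  have -> : (j + n.-1 - size a < size b)%N = false by lia.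
  have -> : (j + n.-1 - size a - size b = (j - size a).-1)%N by lia.
  by case: (j - size a)%N (subn_gt0 (size a) j) => [|d //]; rewrite lt_aj.
- rewrite eq_ja subnn /=; congr F; apply: eq_from_tnth => k.
  rewrite !tnth_mktuple nth_cat ltnNge leq_addr /= addKn nth_cat.
  by rewrite szb ltn_ord.
Qed.

Lemma nested_shift n X (F : n.-tuple X -> X) x i :
  nary_associative F -> (i < n)%N -> nested F x i = nested F x 0.
Proof.
move=> assocF; elim: i => [//|i IHi] lt_in.
by rewrite -assocF // IHi // ltnW.
Qed.

Lemma seq_prod_assoc n X (F : n.-tuple X -> X) x0 a b c a' b' c' :
    nary_associative F -> size b = n -> size b' = n ->
    (size a < n)%N -> (size a' < n)%N ->
    a ++ b ++ c = a' ++ b' ++ c' ->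
  seq_prod F x0 (a ++ seq_prod F x0 b :: c) =
  seq_prod F x0 (a' ++ seq_prod F x0 b' :: c').
Proof.
move=> assocF szb szb' lt_an lt_an' eq_abc.
by rewrite -!nested_cat // eq_abc !(nested_shift _ assocF).
Qed.

(** The bound keeps both swapped entries among the first n: swapping entry
    n - 1 with the ignored entry n would change the value. *)
Lemma seq_prod_swap n X (F : n.-tuple X -> X) x0 p a b q :
    nary_symmetric F -> (size p + 2 <= n)%N ->
  seq_prod F x0 (p ++ a :: b :: q) = seq_prod F x0 (p ++ b :: a :: q).
Proof.
move=> symF le_pn.
have ltin : (size p < n)%N by lia.
have ltjn : ((size p).+1 < n)%N by lia.
pose i := Ordinal ltin; pose j := Ordinal ltjn.
rewrite /seq_prod -[LHS](symF (tperm i j)); congr F.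
apply: eq_from_tnth => k; rewrite !tnth_mktuple.
case: tpermP => [->|->|/eqP ne_ki /eqP ne_kj] /=.
- by rewrite !nth_cat ltnNge leqnSn ltnn subSnn subnn.
- by rewrite !nth_cat [X in if X then _ else nth _ (b :: _) _]ltnNge leqnSn
    ltnn subSnn subnn.
rewrite !nth_cat; case: ltnP => // le_pk.
have {}ne_ki : (k != size p :> nat) by [].
have {}ne_kj : (k != (size p).+1 :> nat) by [].
have -> : (k - size p = (k - size p).-2.+2)%N by lia.
by [].
Qed.

(** * Iterated products *)

(** The product of k (n - 1) + 1 factors obtained by nesting k copies of F to
    the right, n being m + 2: each F takes a block of n - 1 = m + 1 factors and
    the product of the rest. *)
Fixpoint long_prod (m : nat) (X : Type) (F : m.+2.-tuple X -> X) (x0 : X)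
    (k : nat) (s : seq X) : X :=
  if k is k'.+1 then
    seq_prod F x0 (take m.+1 s ++ [:: long_prod F x0 k' (drop m.+1 s)])
  else head x0 s.

Section IteratedProducts.
Variables (m : nat) (X : Type) (F : m.+2.-tuple X -> X) (x0 : X).
Hypotheses (assocF : nary_associative F) (symF : nary_symmetric F).

Local Notation f := (seq_prod F x0).
Local Notation P := (long_prod F x0).

Lemma long_prod_block k w s :
  size w = m.+1 -> P k.+1 (w ++ s) = f (w ++ [:: P k s]).
Proof. by move=> szw /=; rewrite take_size_cat // drop_size_cat. Qed.

(** Adjacent factors in the same block are exchanged by symmetry.  If a ends a
    block and b starts the next one, associativity moves the inner F one place
    to the left, so that it receives both a and b. *)
Lemma long_prod_swap k p a b q :
    size (p ++ a :: b :: q) = (k * m.+1).+1 ->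
  P k (p ++ a :: b :: q) = P k (p ++ b :: a :: q).
Proof.
elim: k p => [|k IHk] p szs; first by move: szs; rewrite size_cat /=; lia.
have {}szs : (size p + (size q).+2 = (k.+1 * m.+1).+1)%N.
  by rewrite -szs size_cat.
have [le_mp|lt_pm] := leqP m.+1 (size p).
- rewrite -(cat_take_drop m.+1 p) -!catA !long_prod_block ?size_takel //.
  by rewrite IHk // size_cat size_drop /=; lia.
have [lt_p1m|le_mp] := ltnP (size p) m.
- have le_rq : (m - (size p).+1 <= size q)%N by nia.
  set r := take (m - (size p).+1) q.
  have split_q x y : p ++ x :: y :: q = (p ++ x :: y :: r) ++
      drop (m - (size p).+1) q by rewrite -catA /= cat_take_drop.
  rewrite !split_q !long_prod_block; last 2 first.
  + by rewrite size_cat /= size_takel //; lia.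
  + by rewrite size_cat /= size_takel //; lia.
  by rewrite -!catA; apply: seq_prod_swap => //; lia.
have szp : size p = m by lia.
(* Now a is the last entry of the first block. *)
rewrite -!(cat_rcons _ p) !long_prod_block ?size_rcons ?szp // !cat_rcons.
case: k {IHk} szs => [|k] szs.
- by apply: seq_prod_swap => //; lia.
have le_mq : (m <= size q)%N by nia.
rewrite -(cat_take_drop m q) -!(cat_cons _ (take m q)).
rewrite !long_prod_block /= ?size_takel //.
set r := P k _; set w := take m q.
have szw : size w = m by rewrite size_takel.
have shift x y : f (p ++ [:: x; f (y :: w ++ [:: r])]) =
    f (p ++ [:: f (x :: y :: w); r]).
  rewrite -cat_rcons; apply: (@seq_prod_assoc _ _ _ _ _ _ [::]) => //=.
  - by rewrite size_cat /= szw addn1.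
  - by rewrite szw.
  - by rewrite size_rcons szp.
  - by rewrite szp.
  - by rewrite cats0 cat_rcons.
by rewrite !shift (@seq_prod_swap _ _ F x0 [::]).
Qed.

Lemma long_prod_perm k s s' :
  Permutation s s' -> size s = (k * m.+1).+1 -> P k s = P k s'.
Proof.
(* A common prefix p is carried along: removing the head from both sequences
   would break the alignment with the blocks. *)
move=> perm_s; suff: forall p, size (p ++ s) = (k * m.+1).+1 ->
    P k (p ++ s) = P k (p ++ s') by move/(_ [::]).
elim: perm_s => {s s'} [//|x s s' _ IHs|x y s|s1 s2 s3 perm12 IH12 _ IH23] p.
- by rewrite -!cat_rcons; apply: IHs.
- exact: long_prod_swap.
- move=> szs; rewrite IH12 // IH23 // -szs !size_cat.
  by congr (_ + _)%N; exact: esym (Permutation_length perm12).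
Qed.

(** As F t is the first factor of the outermost F, associativity moves the
    inner F from the first place to the last, where it meets the rest of the
    product. *)
Lemma long_prod_expand k t s :
    size t = m.+2 -> size s = (k * m.+1)%N ->
  P k (f t :: s) = P k.+1 (t ++ s).
Proof.
move=> szt szs; case/lastP: t szt => // w z; rewrite size_rcons => -[szw].
rewrite cat_rcons long_prod_block //.
case: k szs => [|k] szs; first by rewrite /= cats1.
have le_ms : (m <= size s)%N by nia.
rewrite -(cat_take_drop m s) -!(cat_cons _ (take m s)).
rewrite !long_prod_block /= ?size_takel //.
apply: (@seq_prod_assoc _ _ _ _ [::] (rcons w z) _ _ _ [::]) => //=.
- by rewrite size_rcons szw.
- by rewrite size_cat /= size_takel // addn1.
- by rewrite szw.
- by rewrite cats0 cat_rcons.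
Qed.

(** As [long_prod_expand] acts on the first factor, each expanded t is moved
    behind the copies of F t that remain. *)
Lemma long_prod_expand_nseq k j t s :
    size t = m.+2 -> (j + size s)%N = (k * m.+1).+1 ->
  P k (nseq j (f t) ++ s) = P (j + k) (flatten (nseq j t) ++ s).
Proof.
move=> szt; elim: j k s => [//|j IHj] k s szs.
have sz_njs : size (nseq j (f t) ++ s) = (k * m.+1)%N.
  by rewrite size_cat size_nseq; lia.
rewrite [LHS]long_prod_expand // catA.
have perm_t : Permutation ((t ++ nseq j (f t)) ++ s) (nseq j (f t) ++ t ++ s).
  by rewrite [X in Permutation _ X]catA;
     exact/Permutation_cat2r/Permutation_catC.
rewrite (long_prod_perm perm_t); last by rewrite -catA size_cat sz_njs szt; lia.
rewrite IHj; last by rewrite size_cat szt; lia.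
rewrite addSnnS; apply: long_prod_perm => //.
  by rewrite /= [X in Permutation X _]catA;
     exact/Permutation_cat2r/Permutation_catC.
rewrite !size_cat size_flatten /shape map_nseq sumn_nseq szt; lia.
Qed.

End IteratedProducts.

(** * The maps ell *)

Lemma ell_tuple m (X : Type) (x y : X) :
  [tuple if (i < m.+1)%N then x else y | i < m.+2] =
  nseq m.+1 x ++ [:: y] :> seq X.
Proof.
apply: (@eq_from_nth _ x); first by rewrite size_tuple size_cat size_nseq addn1.
move=> i; rewrite size_tuple => lt_im.
rewrite -[i]/(nat_of_ord (Ordinal lt_im)) -tnth_nth tnth_mktuple nth_cat.
rewrite size_nseq nth_nseq [nat_of_ord _]/=; case: ltnP => // le_mi.
by have -> : (i - m.+1 = 0)%N by lia.
Qed.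

Lemma ellE m (X : Type) (F : m.+2.-tuple X -> X) x0 x y :
  ell F x y = seq_prod F x0 (nseq m.+1 x ++ [:: y]).
Proof. by rewrite -ell_tuple seq_prodE. Qed.

Lemma ell_long_prod m (X : Type) (F : m.+2.-tuple X -> X) x0 x y :
  ell F x y = long_prod F x0 1 (nseq m.+1 x ++ [:: y]).
Proof. by rewrite long_prod_block ?size_nseq // (ellE F x0). Qed.

Section SymmetricBand.
Variables (m : nat) (X : Type) (F : m.+2.-tuple X -> X).
Hypothesis bandF : symmetric_nary_band F.

Let assocF : nary_associative F. Proof. by case: bandF. Qed.
Let symF : nary_symmetric F. Proof. by case: bandF. Qed.

Lemma long_prod_ell x0 t z :
  long_prod F x0 (size t) (flatten [seq nseq m.+1 x | x <- t] ++ [:: z]) =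
  foldr (ell F) z t.
Proof.
elim: t => [//|x t IHt].
by rewrite [RHS]/= -IHt (ellE _ x0) -long_prod_block ?size_nseq // catA.
Qed.

(** The product of n - 1 copies of F t and z has the n - 1 copies of every
    entry of t among its factors once it is expanded. *)
Lemma ell_prod (t : m.+2.-tuple X) z : ell F (F t) z = foldr (ell F) z t.
Proof.
rewrite (ell_long_prod F z).
rewrite -{1}(seq_prodE F z t) (long_prod_expand_nseq z assocF symF);
  rewrite ?size_tuple ?mul1n ?addn1 //.
rewrite -(long_prod_ell z) size_tuple; apply: long_prod_perm => //.
  exact: Permutation_cat2r (Permutation_flatten_nseq _ _).
by rewrite size_cat size_flatten /shape map_nseq sumn_nseq size_tuple /=; lia.
Qed.

Lemma ell_diag x : ell F x x = x.
Proof.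
case: bandF => _ _ idemF; rewrite -[RHS]idemF; congr F.
by apply: eq_from_tnth => i; rewrite !tnth_mktuple if_same.
Qed.

(** Both sides are the product of n - 1 copies of x, n - 1 copies of y,
    and z. *)
Lemma ell_comm x y z : ell F x (ell F y z) = ell F y (ell F x z).
Proof.
rewrite -[LHS](long_prod_ell z [:: x; y]) -[RHS](long_prod_ell z [:: y; x]).
have flat2 u v : flatten [seq nseq m.+1 w | w <- [:: u; v]] =
    nseq m.+1 u ++ nseq m.+1 v by rewrite [LHS]/= cats0.
rewrite !flat2; apply: long_prod_perm => //.
  by exact/Permutation_cat2r/Permutation_catC.
by rewrite !size_cat !size_nseq /=; lia.
Qed.

(** Among the 2 (n - 1) copies of x in the product, n can be merged into the
    single factor F (x, .., x) = x, which leaves n - 1 copies. *)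
Lemma ell_idem x z : ell F x (ell F x z) = ell F x z.
Proof.
have f_x : seq_prod F z (nseq m.+2 x) = x.
  rewrite (seq_prodE F z (nseq_tuple m.+2 x)) -[RHS]ell_diag; congr F.
  by apply: eq_from_tnth => i; rewrite tnth_mktuple if_same tnth_nseq.
rewrite -[LHS](long_prod_ell z [:: x; x]) -[RHS](long_prod_ell z [:: x]).
have -> : flatten [seq nseq m.+1 y | y <- [:: x; x]] ++ [:: z] =
    nseq m.+2 x ++ (nseq m x ++ [:: z]).
  by rewrite [flatten _]/= cats0 catA -(nseqD m.+2 m) addSnnS nseqD.
rewrite -(long_prod_expand z assocF); last 2 first.
- by rewrite size_nseq.
- by rewrite size_cat size_nseq mul1n addn1.
by rewrite f_x [flatten _]/= cats0.
Qed.

(** Apply [ell_prod] to (x, .., x, y); by idempotence the n - 1 factors ell x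
    collapse to one. *)
Lemma ell_ell x y z : ell F (ell F x y) z = ell F x (ell F y z).
Proof.
rewrite [X in ell F X z]/ell ell_prod ell_tuple foldr_cat /=.
suff collapse k :
    foldr (ell F) (ell F y z) (nseq k.+1 x) = ell F x (ell F y z).
  exact: collapse m.
by elim: k => [//|k IHk]; rewrite -[RHS]ell_idem -IHk.
Qed.

Lemma ell_foldl x s z :
  ell F (foldl (binary_op F) x s) z = foldr (ell F) z (x :: s).
Proof.
elim/last_ind: s z => [//|s y IHs] z.
by rewrite foldl_rcons ell_ell IHs -rcons_cons foldr_rcons.
Qed.

Lemma inj_ell_comm : injective (ell F) -> commutative (binary_op F).
Proof.
move=> inj_ell x y; apply: inj_ell; apply: functional_extensionality => z.
by rewrite !ell_ell ell_comm.
Qed.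

Lemma inj_ell_extension :
  injective (ell F) -> nary_extension_of (binary_op F) F.
Proof.
move=> inj_ell t x s def_t; apply: inj_ell.
by apply: functional_extensionality => z; rewrite ell_prod ell_foldl def_t.
Qed.

Lemma comm_inj_ell : commutative (binary_op F) -> injective (ell F).
Proof.
move=> commB x y eq_xy.
rewrite -[LHS]ell_diag eq_xy.
by rewrite (commB y x : ell F y x = ell F x y) eq_xy ell_diag.
Qed.

(** The product of (x, .., x, y) is B x y by definition, and that of
    (y, x, .., x) is B y x because B (B y x) x = B y (B x x) = B y x. *)
Lemma extension_comm :
  nary_extension_of (binary_op F) F -> commutative (binary_op F).
Proof.
move=> extF x y; pose t := [tuple of y :: nseq_tuple m.+1 x].
have -> : binary_op F y x = F t.
  rewrite (extF t y (nseq m.+1 x)) //.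
  suff absorb k :
      foldl (binary_op F) y (nseq k.+1 x) = binary_op F y x by rewrite absorb.
  elim: k => [//|k IHk]; rewrite -[in RHS]IHk /=; congr foldl.
  by rewrite [LHS]ell_ell ell_diag.
rewrite -(seq_prodE F x) [LHS](ell_long_prod F x).
have -> : tval t = (y :: nseq m x) ++ [:: x].
  by rewrite cat_cons -(nseqD m 1) addn1.
have <- := long_prod_block F x 0 [:: x]; last by rewrite /= size_nseq.
apply: long_prod_perm => //; last by rewrite size_cat size_nseq mul1n addn1.
rewrite cat_cons -(nseqD m 1) addn1; exact: (Permutation_catC _ [:: y]).
Qed.

Lemma binary_op_semilattice :
  commutative (binary_op F) -> semilattice (binary_op F).
Proof. by split=> // [x y z|x]; [rewrite [RHS]ell_ell | apply: ell_diag]. Qed.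

End SymmetricBand.

Lemma extension_ell m (Y : Type) (op : Y -> Y -> Y) (G : m.+2.-tuple Y -> Y) :
    idempotent_op op -> nary_extension_of op G ->
  forall x y, binary_op G x y = op x y.
Proof.
move=> idem_op extG x y; rewrite [LHS](extG _ _ _ (ell_tuple m x y)) foldl_cat.
by rewrite /=; congr op; elim: m {G extG} => [//|k IHk] /=; rewrite idem_op.
Qed.

Theorem proposition3p8 (n : nat) (X : Type) (F : n.-tuple X -> X)
    (hX : inhabited X) (hn : (2 <= n)%N) (hF : symmetric_nary_band F) :
  [<-> injective (ell F);
       exists (Y : Type) (op : Y -> Y -> Y) (G : n.-tuple Y -> Y),
         [/\ semilattice op, nary_extension_of op G & nary_isomorphic F G];
       commutative (binary_op F);
       nary_extension_of (binary_op F) F].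
Proof.
case: n F hn hF => [//|[//|m]] F _ bandF; tfae.
- move=> inj_ell; exists X, (binary_op F), F; split.
  + exact/binary_op_semilattice/inj_ell_comm.
  + exact: inj_ell_extension.
  + exists id => [|t]; first by exists id.
    by congr F; apply: val_inj; rewrite /= map_id.
- case=> Y [op [G [[_ idem_op comm_op] extG [phi bij_phi morph_phi]]]] x y.
  have phiB u v : phi (binary_op F u v) = op (phi u) (phi v).
    rewrite morph_phi -(extension_ell idem_op extG); congr G.
    by apply: eq_from_tnth => i; rewrite tnth_map !tnth_mktuple; case: ifP.
  by apply: (bij_inj bij_phi); rewrite !phiB comm_op.
- by move=> /(comm_inj_ell bandF)/(inj_ell_extension bandF).
- move=> extB; exact/(comm_inj_ell bandF)/(extension_comm bandF).
Qed.
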